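(* Every algebraic theory $\mathbb{T}$ admits a classifying category: there is a monoidal category $\mathbf{T}$ together with equivalences of categories $\hom(\mathbf{T},\mathbf{C})\simeq\mathrm{Mod}(\mathbb{T},\mathbf{C})$, natural in the monoidal category $\mathbf{C}$.
   Context: Algebraic languages: fix a finitary many-sorted signature $\Sigma$ (atomic types; functional constants $f\colon B_1,\dots,B_n\to B_{n+1}$). Types are finite sequences of atomic types (juxtaposition; $\emptyset$ empty). Raw terms: $t::=\emptyset\mid x\mid f(t_1,\dots,t_n)\mid tt$, tensor associative with unit $\emptyset$; $t[s/x]$ is simultaneous substitution of $s=s_1\dots s_n$ for distinct atomic variables $x=x_1\dots x_n$. Sequents $x:A\vdash t:B$ with $x$ distinct atomic variables. Term calculus: Variables $x:A\vdash x:A$ ($x,A$ atomic); Functions: from $x_i:A_i\vdash t_i:B_i$ infer $x_1\dots x_n:A_1\dots A_n\vdash f(t_1,\dots,t_n):B_{n+1}$; Substitution: from $x:A\vdash s:B$, $y:B\vdash t:C$ infer $x:A\vdash t[s/y]:C$; Unit $\emptyset:\emptyset\vdash\emptyset:\emptyset$; Tensor: from $x:A\vdash s:B$, $y:C\vdash t:D$ infer $xy:AC\vdash st:BD$; Weakening: from $x_1x_3:A_1A_3\vdash t:B$ infer $x_1x_2x_3:A_1A_2A_3\vdash t:B$; Exchange: from $x:A\vdash t:B$ infer $\sigma x:\sigma A\vdash t:B$; Contraction: from $x_1xx'x_2:A_1AAA_2\vdash t:B$ infer $x_1xx_2:A_1AA_2\vdash t[x/x']:B$. An algebraic language $L$ is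 $\Sigma$ plus a subset of {weakening, exchange, contraction}; its terms are the sequents derivable with all non-structural rules and its structural rules. Theories: an $L$-formula is $x:A\vdash t_1=_Bt_2$ with both $x:A\vdash t_i:B$ terms of $L$. The deduction calculus of $L$ consists of reflexivity, symmetry, transitivity of $=$; substitution (from $x:A\vdash s=_Bs'$ and $y:B\vdash t=_Ct'$ infer $x:A\vdash t[s/y]=_Ct'[s'/y]$); tensor (from $x:A\vdash s=_Ss'$, $y:B\vdash t=_Tt'$ infer $xy:AB\vdash st=_{ST}s't'$); and the structural rules of $L$ applied to formulas (to both sides simultaneously). An algebraic theory $\mathbb{T}$ is an algebraic language $L$ with a set of $L$-formulas (axioms); its theorems are the formulas deducible from the axioms. Semantics: in a monoidal category $\mathbf{C}$, an $L$-prestructure assigns objects $|A|$ to atomic types (extended by tensor, $|\emptyset|=1$), arrows $|f|\colon|B_1|\dots|B_n|\to|B_{n+1}|$, and for the structural rules of $L$ arrows $\pi_A\colon|A|\to1$, $\sigma_A\colon|\sigma A|\to|A|$, $\Delta_A\colon|A|\to|AA|$ for all types $A$. Derivations of terms are interpreted inductively (variables as identities, functions as tensor followed by $|f|$, substitution as composition, tensor as tensor, structural rules as precomposition with $1\pi_A1$, $\sigma_A$, $1\Delta_A1$, coherence isomorphisms inserted as needed); an $L$-structure is a prestructure whose interpretation of every term is independent of the derivation. A morphism $h\colon M\to N$: arrows $h_A\colon|A|_M\to|A|_N$ for atomic $A$, extended by tensor, commuting with the interpretations of all terms. $M$ satisfies $x:A\vdash s=_Bt$ iff $|s|_M=|t|_M$;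 a $\mathbb{T}$-model is an $L$-structure satisfying all axioms; $\mathrm{Mod}(\mathbb{T},\mathbf{C})$ is the full subcategory of models. $\hom(\mathbf{T},\mathbf{C})$ is the category of strong monoidal functors and monoidal natural transformations; a strong monoidal functor $F\colon\mathbf{C}\to\mathbf{D}$ induces $\mathrm{Mod}(\mathbb{T},\mathbf{C})\to\mathrm{Mod}(\mathbb{T},\mathbf{D})$ by applying $F$ to all interpreting objects and arrows and correcting by the coherence isomorphisms of $F$ (and monoidal transformations induce morphisms of models); naturality in $\mathbf{C}$ refers to this 2-functoriality. *)

(* Defs.v *)
From mathcomp Require Import all_boot perm.
From Stdlib Require Import FunctionalExtensionality ProofIrrelevance.

Set Implicit Arguments.
Unset Strict Implicit.
Unset Printing Implicit Defensive.

Declare Scope cat_scope.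
Delimit Scope cat_scope with cat.
Local Open Scope cat_scope.

Local Obligation Tactic := intros; simpl.

Record Category := {
  obj :> Type;
  hom : obj -> obj -> Type;
  idm : forall x, hom x x;
  compm : forall x y z, hom y z -> hom x y -> hom x z;
  comp1m : forall x y (f : hom x y), compm (idm y) f = f;
  compm1 : forall x y (f : hom x y), compm f (idm x) = f;
  compmA : forall x y z w (h : hom z w) (g : hom y z) (f : hom x y),
    compm h (compm g f) = compm (compm h g) f
}.
Arguments hom {c} x y.
Arguments idm {c} x.
Arguments compm {c x y z} g f.
Notation "g ∘ f" := (compm g f) (at level 40, left associativity) : cat_scope.

Record iso (C : Category) (x y : C) := {
  fwd :> hom x y;
  bwd : hom y x;
  fwdK : bwd ∘ fwd = idm x;
  bwdK : fwd ∘ bwd = idm y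
}.
Arguments iso {C} x y.

Lemma iso_mono (C : Category) (x y z : C) (i : iso y z) (f g : hom x y) :
  i ∘ f = i ∘ g -> f = g.
Proof.
move=> e; rewrite -[f]comp1m -[g]comp1m -(fwdK i).
by rewrite -!compmA e.
Qed.

Lemma iso_epi (C : Category) (x y z : C) (i : iso x y) (f g : hom y z) :
  f ∘ i = g ∘ i -> f = g.
Proof.
move=> e; rewrite -[f]compm1 -[g]compm1 -(bwdK i).
by rewrite !compmA e.
Qed.

Lemma iso_ext (C : Category) (x y : C) (i j : iso x y) :
  fwd i = fwd j -> i = j.
Proof.
case: i j => [f g p q] [f' g' p' q'] /= e; subst f'.
have e : g = g' by rewrite -[g]compm1 -q' compmA p comp1m.
by subst g'; f_equal; apply: proof_irrelevance.
Qed.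

Definition iso_id (C : Category) (x : C) : iso x x :=
  {| fwd := idm x; bwd := idm x; fwdK := comp1m _; bwdK := comp1m _ |}.

Program Definition iso_comp (C : Category) (x y z : C)
    (j : iso y z) (i : iso x y) : iso x z :=
  {| fwd := j ∘ i; bwd := bwd i ∘ bwd j |}.
Next Obligation.
by rewrite -compmA [bwd j ∘ _]compmA fwdK comp1m fwdK.
Qed.
Next Obligation.
by rewrite -compmA [i ∘ _]compmA bwdK comp1m bwdK.
Qed.

Definition iso_inv (C : Category) (x y : C) (i : iso x y) : iso y x :=
  {| fwd := bwd i; bwd := i; fwdK := bwdK i; bwdK := fwdK i |}.

Definition eq_mor (C : Category) (x y : C) (e : x = y) : hom x y :=
  match e in _ = z return hom x z with erefl => idm x end.

Record Functor (C D : Category) := {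
  fobj :> C -> D;
  fmap : forall x y, hom x y -> hom (fobj x) (fobj y);
  fmap1 : forall x, fmap (idm x) = idm (fobj x);
  fmapM : forall x y z (g : hom y z) (f : hom x y),
    fmap (g ∘ f) = fmap g ∘ fmap f
}.
Arguments fmap {C D} F {x y} f : rename.

Definition functor_id (C : Category) : Functor C C :=
  {| fobj := fun x => x; fmap := fun _ _ f => f;
     fmap1 := fun _ => erefl; fmapM := fun _ _ _ _ _ => erefl |}.

Program Definition functor_comp (C D E : Category)
    (G : Functor D E) (F : Functor C D) : Functor C E :=
  {| fobj := fun x => G (F x); fmap := fun _ _ f => fmap G (fmap F f) |}.
Next Obligation. by rewrite !fmap1. Qed.
Next Obligation. by rewrite !fmapM. Qed.

Program Definition fmap_iso (C D : Category) (F : Functor C D) (x y : C)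
    (i : iso x y) : iso (F x) (F y) :=
  {| fwd := fmap F i; bwd := fmap F (bwd i) |}.
Next Obligation. by rewrite -fmapM fwdK fmap1. Qed.
Next Obligation. by rewrite -fmapM bwdK fmap1. Qed.

Definition nat_iso (C D : Category) (F G : Functor C D) : Prop :=
  exists a : forall x : C, iso (F x) (G x),
    forall (x y : C) (f : hom x y), a y ∘ fmap F f = fmap G f ∘ a x.

Definition is_equivalence (C D : Category) (F : Functor C D) : Prop :=
  exists K : Functor D C,
    nat_iso (functor_comp K F) (functor_id C) /\
    nat_iso (functor_comp F K) (functor_id D).

Reserved Notation "x ⊗ y" (at level 38, right associativity).
Reserved Notation "f ⊠ g" (at level 38, right associativity).

Record MonCat := {
  mcat :> Category;
  munit : mcat;
  tens : mcat -> mcat -> mcat where "x ⊗ y" := (tens x y);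
  tensm : forall x y x' y' : mcat,
    hom x x' -> hom y y' -> hom (x ⊗ y) (x' ⊗ y')
    where "f ⊠ g" := (tensm f g);
  tensm1 : forall x y, idm x ⊠ idm y = idm (x ⊗ y);
  tensmM : forall (x y x' y' x'' y'' : mcat) (f' : hom x' x'') (f : hom x x')
    (g' : hom y' y'') (g : hom y y'),
    (f' ∘ f) ⊠ (g' ∘ g) = (f' ⊠ g') ∘ (f ⊠ g);
  assoc : forall x y z, iso ((x ⊗ y) ⊗ z) (x ⊗ (y ⊗ z));
  lunit : forall x, iso (munit ⊗ x) x;
  runit : forall x, iso (x ⊗ munit) x;
  assoc_nat : forall (x y z x' y' z' : mcat)
    (f : hom x x') (g : hom y y') (h : hom z z'),
    assoc x' y' z' ∘ ((f ⊠ g) ⊠ h) = (f ⊠ (g ⊠ h)) ∘ assoc x y z;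
  lunit_nat : forall (x x' : mcat) (f : hom x x'),
    lunit x' ∘ (idm munit ⊠ f) = f ∘ lunit x;
  runit_nat : forall (x x' : mcat) (f : hom x x'),
    runit x' ∘ (f ⊠ idm munit) = f ∘ runit x;
  pentagon : forall x y z w,
    assoc x y (z ⊗ w) ∘ assoc (x ⊗ y) z w =
    (idm x ⊠ assoc y z w) ∘ assoc x (y ⊗ z) w ∘ (assoc x y z ⊠ idm w);
  triangle : forall x y,
    (idm x ⊠ lunit y) ∘ assoc x munit y = runit x ⊠ idm y
}.
Arguments munit {m}.
Arguments tens {m} x y.
Arguments tensm {m x y x' y'} f g.
Arguments assoc {m} x y z.
Arguments lunit {m} x.
Arguments runit {m} x.
Notation "x ⊗ y" := (tens x y) : cat_scope.
Notation "f ⊠ g" := (tensm f g) : cat_scope.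

Program Definition tens_iso (C : MonCat) (x y x' y' : C)
    (i : iso x x') (j : iso y y') : iso (x ⊗ y) (x' ⊗ y') :=
  {| fwd := i ⊠ j; bwd := bwd i ⊠ bwd j |}.
Next Obligation. by rewrite -tensmM !fwdK tensm1. Qed.
Next Obligation. by rewrite -tensmM !bwdK tensm1. Qed.

Record SMFunctor (C D : MonCat) := {
  smf :> Functor C D;
  phi : forall x y, iso (smf x ⊗ smf y) (smf (x ⊗ y));
  phi0 : iso munit (smf munit);
  phi_nat : forall x y x' y' (f : hom x x') (g : hom y y'),
    phi x' y' ∘ (fmap smf f ⊠ fmap smf g) = fmap smf (f ⊠ g) ∘ phi x y;
  phi_assoc : forall x y z,
    fmap smf (assoc x y z) ∘ phi (x ⊗ y) z ∘ (phi x y ⊠ idm (smf z)) =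
    phi x (y ⊗ z) ∘ (idm (smf x) ⊠ phi y z) ∘ assoc (smf x) (smf y) (smf z);
  phi_lunit : forall x,
    fmap smf (lunit x) ∘ phi munit x ∘ (phi0 ⊠ idm (smf x)) = lunit (smf x);
  phi_runit : forall x,
    fmap smf (runit x) ∘ phi x munit ∘ (idm (smf x) ⊠ phi0) = runit (smf x)
}.
Arguments phi {C D} F x y : rename.
Arguments phi0 {C D} F : rename.

Program Definition sm_comp (C D E : MonCat)
    (G : SMFunctor D E) (F : SMFunctor C D) : SMFunctor C E :=
  {| smf := functor_comp G F;
     phi := fun x y => iso_comp (fmap_iso G (phi F x y)) (phi G (F x) (F y));
     phi0 := iso_comp (fmap_iso G (phi0 F)) (phi0 G) |}.
Next Obligation.
by rewrite -compmA phi_nat !compmA -!fmapM phi_nat.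
Qed.
Next Obligation.
have nl : (fmap G (phi F x y) ∘ phi G (F x) (F y)) ⊠ idm (G (F z)) =
    (fmap G (phi F x y) ⊠ fmap G (idm (F z))) ∘ (phi G (F x) (F y) ⊠ idm _).
  by rewrite -tensmM fmap1 comp1m.
have nr : idm (G (F x)) ⊠ (fmap G (phi F y z) ∘ phi G (F y) (F z)) =
    (fmap G (idm (F x)) ⊠ fmap G (phi F y z)) ∘ (idm _ ⊠ phi G (F y) (F z)).
  by rewrite -tensmM fmap1 comp1m.
rewrite nl nr !compmA -[X in X ∘ _ = _]compmA phi_nat.
rewrite -[X in _ = X ∘ _ ∘ _]compmA phi_nat !compmA -!fmapM.
rewrite phi_assoc !fmapM -!compmA; congr (_ ∘ (_ ∘ _)).
by rewrite !compmA phi_assoc.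
Qed.
Next Obligation.
have nl : (fmap G (phi0 F) ∘ phi0 G) ⊠ idm (G (F x)) =
    (fmap G (phi0 F) ⊠ fmap G (idm (F x))) ∘ (phi0 G ⊠ idm _).
  by rewrite -tensmM fmap1 comp1m.
rewrite nl !compmA -[X in X ∘ _ = _]compmA phi_nat !compmA -!fmapM.
by rewrite phi_lunit phi_lunit.
Qed.
Next Obligation.
have nr : idm (G (F x)) ⊠ (fmap G (phi0 F) ∘ phi0 G) =
    (fmap G (idm (F x)) ⊠ fmap G (phi0 F)) ∘ (idm _ ⊠ phi0 G).
  by rewrite -tensmM fmap1 comp1m.
rewrite nr !compmA -[X in X ∘ _ = _]compmA phi_nat !compmA -!fmapM.
by rewrite phi_runit phi_runit.
Qed.

Record MonTrans (C D : MonCat) (F G : SMFunctor C D) := {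
  mt :> forall x : C, hom (F x) (G x);
  mt_nat : forall (x y : C) (f : hom x y), mt y ∘ fmap F f = fmap G f ∘ mt x;
  mt_phi : forall x y : C, mt (x ⊗ y) ∘ phi F x y = phi G x y ∘ (mt x ⊠ mt y);
  mt_phi0 : mt munit ∘ phi0 F = phi0 G
}.

Lemma MonTrans_ext (C D : MonCat) (F G : SMFunctor C D) (a b : MonTrans F G) :
  (forall x, a x = b x) -> a = b.
Proof.
case: a b => [a p q r] [b p' q' r'] /= e.
have e' : a = b by apply: functional_extensionality_dep.
by subst b; f_equal; apply: proof_irrelevance.
Qed.

Program Definition mt_id (C D : MonCat) (F : SMFunctor C D) : MonTrans F F :=
  {| mt := fun x => idm (F x) |}.
Next Obligation. by rewrite comp1m compm1. Qed.
Next Obligation. by rewrite tensm1 comp1m compm1. Qed.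
Next Obligation. by rewrite comp1m. Qed.

Program Definition mt_comp (C D : MonCat) (F G H : SMFunctor C D)
    (b : MonTrans G H) (a : MonTrans F G) : MonTrans F H :=
  {| mt := fun x => b x ∘ a x |}.
Next Obligation. by rewrite -compmA mt_nat !compmA mt_nat. Qed.
Next Obligation. by rewrite tensmM -compmA mt_phi !compmA mt_phi. Qed.
Next Obligation. by rewrite -compmA !mt_phi0. Qed.

Program Definition Hom (C D : MonCat) : Category :=
  {| obj := SMFunctor C D; hom := @MonTrans C D;
     idm := @mt_id C D; compm := @mt_comp C D |}.
Next Obligation. by apply: MonTrans_ext => x0 /=; rewrite comp1m. Qed.
Next Obligation. by apply: MonTrans_ext => x0 /=; rewrite compm1. Qed.
Next Obligation. by apply: MonTrans_ext => x0 /=; rewrite compmA. Qed.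

Program Definition whiskerl (B C D : MonCat) (F : SMFunctor C D)
    (G G' : SMFunctor B C) (a : MonTrans G G') :
    MonTrans (sm_comp F G) (sm_comp F G') :=
  {| mt := fun x => fmap F (a x) |}.
Next Obligation. by rewrite -!fmapM mt_nat. Qed.
Next Obligation.
rewrite compmA -fmapM mt_phi fmapM -!compmA; congr (_ ∘ _).
by rewrite phi_nat.
Qed.
Next Obligation. by rewrite compmA -fmapM mt_phi0. Qed.

Program Definition whiskerr (B C D : MonCat) (F F' : SMFunctor C D)
    (a : MonTrans F F') (G : SMFunctor B C) :
    MonTrans (sm_comp F G) (sm_comp F' G) :=
  {| mt := fun x => a (G x) |}.
Next Obligation. by rewrite mt_nat. Qed.
Next Obligation. by rewrite compmA mt_nat -!compmA mt_phi. Qed.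
Next Obligation. by rewrite compmA mt_nat -compmA mt_phi0. Qed.

Program Definition Hom_map (B C D : MonCat) (F : SMFunctor C D) :
    Functor (Hom B C) (Hom B D) :=
  {| fobj := sm_comp F : Hom B C -> Hom B D; fmap := whiskerl F |}.
Next Obligation. by apply: MonTrans_ext => y /=; rewrite fmap1. Qed.
Next Obligation. by apply: MonTrans_ext => w /=; rewrite fmapM. Qed.

Record signature := {
  sort : Type;
  op : Type;
  dom : op -> seq sort;
  cod : op -> sort
}.

Inductive rule := Weakening | Exchange | Contraction.

Record language := {
  sig :> signature;
  has_rule : rule -> bool
}.

(* A raw term is a [seq (atom S)]: the tensor of raw terms is concatenation and
   the raw term ∅ is [::]. *)
Inductive atom (S : signature) : Type :=
| Var of nat
| App (f : op S) of seq (atom S).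
Arguments Var {S} v.
Arguments App {S} f ts.

(* Simultaneous substitution; [index v y = size y] when [v] is not in [y]. *)
Fixpoint subst1 (S : signature) (y : seq nat) (s : seq (atom S))
    (t : atom S) : atom S :=
  match t with
  | Var v => nth (Var v) s (index v y)
  | App f ts => App f [seq subst1 y s u | u <- ts]
  end.

Definition subst (S : signature) (y : seq nat) (s t : seq (atom S)) :=
  [seq subst1 y s u | u <- t].

(* (σA)_i = A_(σ i). *)
Definition permute (n : nat) (s : 'S_n) (T : Type) (x : n.-tuple T) :
    n.-tuple T := [tuple tnth x (s i) | i < n].

(* [deriv L x A t B] is the type of derivations of the sequent x : A ⊢ t : B.
   [derivs L x A t B] is the type of finite sequences of derivations of
   sequents x_i : A_i ⊢ t_i : B_i with t_i and B_i atomic, where x, A, t and B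
   are the concatenations of the x_i, A_i, t_i and B_i. *)
Inductive deriv (L : language) :
    seq nat -> seq (sort L) -> seq (atom L) -> seq (sort L) -> Type :=
| DVar (x : nat) (A : sort L) : deriv [:: x] [:: A] [:: Var x] [:: A]
| DFun (f : op L) x A t :
    uniq x -> derivs x A t (dom f) -> deriv x A [:: App f t] [:: cod f]
| DSubst x A s B y t C :
    deriv x A s B -> deriv y B t C -> deriv x A (subst y s t) C
| DUnit : deriv [::] [::] [::] [::]
| DTens x A s B y C t D :
    uniq (x ++ y) -> deriv x A s B -> deriv y C t D ->
    deriv (x ++ y) (A ++ C) (s ++ t) (B ++ D)
| DWeak x1 x2 x3 A1 A2 A3 t B :
    has_rule L Weakening -> uniq (x1 ++ x2 ++ x3) ->
    size x1 = size A1 -> size x2 = size A2 ->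
    deriv (x1 ++ x3) (A1 ++ A3) t B ->
    deriv (x1 ++ x2 ++ x3) (A1 ++ A2 ++ A3) t B
| DExch n (s : 'S_n) (x : n.-tuple nat) (A : n.-tuple (sort L)) t B :
    has_rule L Exchange ->
    deriv x A t B -> deriv (permute s x) (permute s A) t B
| DContr x1 x x' x2 A1 A A2 t B :
    has_rule L Contraction ->
    size x1 = size A1 -> size x = size A -> size x' = size A ->
    deriv (x1 ++ (x ++ x') ++ x2) (A1 ++ (A ++ A) ++ A2) t B ->
    deriv (x1 ++ x ++ x2) (A1 ++ A ++ A2)
      (subst x' [seq Var v | v <- x] t) B
with derivs (L : language) :
    seq nat -> seq (sort L) -> seq (atom L) -> seq (sort L) -> Type :=
| DNil : derivs [::] [::] [::] [::]
| DCons x A t B xs As ts Bs :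
    deriv x A [:: t] [:: B] -> derivs xs As ts Bs ->
    derivs (x ++ xs) (A ++ As) (t :: ts) (B :: Bs).

Scheme deriv_mut := Induction for deriv Sort Prop
with derivs_mut := Induction for derivs Sort Prop.
Combined Scheme deriv_derivs_ind from deriv_mut, derivs_mut.

Definition is_term (L : language) x A t B : Prop := inhabited (@deriv L x A t B).

Record formula (L : language) := {
  fvars : seq nat;
  fdom : seq (sort L);
  flhs : seq (atom L);
  frhs : seq (atom L);
  fcod : seq (sort L);
  flhsP : is_term fvars fdom flhs fcod;
  frhsP : is_term fvars fdom frhs fcod
}.

Record theory := {
  lang :> language;
  axioms : formula lang -> Prop
}.

Definition ty (T : Type) (C : MonCat) (ob : T -> C) (A : seq T) : C :=
  foldr (fun a X => ob a ⊗ X) munit A.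

Fixpoint ty_cat (T : Type) (C : MonCat) (ob : T -> C) (A B : seq T) :
    iso (ty ob (A ++ B)) (ty ob A ⊗ ty ob B) :=
  match A with
  | [::] => iso_inv (lunit (ty ob B))
  | a :: A' => iso_comp (iso_inv (assoc (ob a) (ty ob A') (ty ob B)))
                 (tens_iso (iso_id (ob a)) (ty_cat ob A' B))
  end.

Fixpoint ty_hom (T : Type) (C : MonCat) (ob ob' : T -> C)
    (h : forall a, hom (ob a) (ob' a)) (A : seq T) :
    hom (ty ob A) (ty ob' A) :=
  match A with
  | [::] => idm munit
  | a :: A' => h a ⊠ ty_hom h A'
  end.

(* The tensor of arrows between interpretations of types, with the coherence
   isomorphisms of [ty_cat] inserted. *)
Definition ty_tens (T : Type) (C : MonCat) (ob : T -> C) (A B A' B' : seq T)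
    (f : hom (ty ob A) (ty ob B)) (g : hom (ty ob A') (ty ob B')) :
    hom (ty ob (A ++ A')) (ty ob (B ++ B')) :=
  bwd (ty_cat ob B B') ∘ (f ⊠ g) ∘ ty_cat ob A A'.

Record prestructure (L : language) (C : MonCat) := {
  ob :> sort L -> C;
  iop : forall f : op L, hom (ty ob (dom f)) (ob (cod f));
  iweak : has_rule L Weakening -> forall A : seq (sort L), hom (ty ob A) munit;
  iexch : has_rule L Exchange -> forall n (s : 'S_n) (A : n.-tuple (sort L)),
    hom (ty ob (permute s A)) (ty ob A);
  icontr : has_rule L Contraction -> forall A : seq (sort L),
    hom (ty ob A) (ty ob (A ++ A))
}.

Fixpoint interp (L : language) (C : MonCat) (M : prestructure L C) x A t B
    (d : deriv x A t B) : hom (ty M A) (ty M B) :=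
  match d in deriv _ A t B return hom (ty M A) (ty M B) with
  | DVar _ A => idm (ty M [:: A])
  | DFun f _ _ _ _ ds => bwd (runit (M (cod f))) ∘ iop M f ∘ interps M ds
  | DSubst _ _ _ _ _ _ _ d1 d2 => interp M d2 ∘ interp M d1
  | DUnit => idm munit
  | DTens _ _ _ _ _ _ _ _ _ d1 d2 => ty_tens (interp M d1) (interp M d2)
  | DWeak _ _ _ A1 A2 A3 _ _ w _ _ _ d1 =>
      interp M d1 ∘
      ty_tens (B := A1) (B' := A3) (idm (ty M A1))
        (ty_tens (B := [::]) (B' := A3) (iweak M w A2) (idm (ty M A3)))
  | DExch _ s _ A _ _ e d1 => interp M d1 ∘ iexch M e s A
  | DContr _ _ _ _ A1 A A2 _ _ c _ _ _ d1 =>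
      interp M d1 ∘
      ty_tens (idm (ty M A1)) (ty_tens (icontr M c A) (idm (ty M A2)))
  end
with interps (L : language) (C : MonCat) (M : prestructure L C) x A t B
    (d : derivs x A t B) : hom (ty M A) (ty M B) :=
  match d in derivs _ A t B return hom (ty M A) (ty M B) with
  | DNil => idm munit
  | DCons _ _ _ B _ _ _ _ d1 ds =>
      ty_tens (B := [:: B]) (interp M d1) (interps M ds)
  end.

Record structure (L : language) (C : MonCat) := {
  prestr :> prestructure L C;
  interp_irrel : forall x A t B (d d' : deriv x A t B),
    interp prestr d = interp prestr d'
}.

Definition satisfies (L : language) (C : MonCat) (M : structure L C)
    (e : formula L) : Prop :=
  forall (d : deriv (fvars e) (fdom e) (flhs e) (fcod e))
    (d' : deriv (fvars e) (fdom e) (frhs e) (fcod e)),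
  interp M d = interp M d'.

Record model (Th : theory) (C : MonCat) := {
  str :> structure Th C;
  sat : forall e : formula Th, axioms e -> satisfies str e
}.

Record str_mor (L : language) (C : MonCat) (M N : prestructure L C) := {
  smor :> forall a : sort L, hom (M a) (N a);
  smor_interp : forall x A t B (d : deriv x A t B),
    ty_hom smor B ∘ interp M d = interp N d ∘ ty_hom smor A
}.

Lemma str_mor_ext (L : language) (C : MonCat) (M N : prestructure L C)
    (h k : str_mor M N) : (forall a, h a = k a) -> h = k.
Proof.
case: h k => [h p] [k q] /= e.
have e' : h = k by apply: functional_extensionality_dep.
by subst k; f_equal; apply: proof_irrelevance.
Qed.

Lemma ty_hom1 (T : Type) (C : MonCat) (ob : T -> C) (A : seq T) :
  ty_hom (fun a => idm (ob a)) A = idm (ty ob A).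
Proof. by elim: A => //= a A ->; rewrite tensm1. Qed.

Lemma ty_homM (T : Type) (C : MonCat) (o1 o2 o3 : T -> C)
    (k : forall a, hom (o2 a) (o3 a)) (h : forall a, hom (o1 a) (o2 a))
    (A : seq T) :
  ty_hom (fun a => k a ∘ h a) A = ty_hom k A ∘ ty_hom h A.
Proof. by elim: A => [|a A /= ->]; rewrite ?comp1m ?tensmM. Qed.

Program Definition str_mor_id (L : language) (C : MonCat)
    (M : prestructure L C) : str_mor M M :=
  {| smor := fun a => idm (M a) |}.
Next Obligation. by rewrite !ty_hom1 comp1m compm1. Qed.

Program Definition str_mor_comp (L : language) (C : MonCat)
    (M N P : prestructure L C) (k : str_mor N P) (h : str_mor M N) :
    str_mor M P :=
  {| smor := fun a => k a ∘ h a |}.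
Next Obligation.
by rewrite !ty_homM -compmA smor_interp !compmA smor_interp.
Qed.

Program Definition Mod (Th : theory) (C : MonCat) : Category :=
  {| obj := model Th C; hom := fun M N => str_mor M N;
     idm := fun M => str_mor_id M;
     compm := fun M N P k h => str_mor_comp k h |}.
Next Obligation. by apply: str_mor_ext => a /=; rewrite comp1m. Qed.
Next Obligation. by apply: str_mor_ext => a /=; rewrite compm1. Qed.
Next Obligation. by apply: str_mor_ext => a /=; rewrite compmA. Qed.

Fixpoint phi_ty (T : Type) (C D : MonCat) (F : SMFunctor C D) (ob : T -> C)
    (A : seq T) : iso (ty (fun a => F (ob a)) A) (F (ty ob A)) :=
  match A with
  | [::] => phi0 F
  | a :: A' => iso_comp (phi F (ob a) (ty ob A'))
                 (tens_iso (iso_id (F (ob a))) (phi_ty F ob A'))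
  end.

Definition push_pre (L : language) (C D : MonCat) (F : SMFunctor C D)
    (M : prestructure L C) : prestructure L D :=
  {| ob := fun a => F (M a);
     iop := fun f => fmap F (iop M f) ∘ phi_ty F M (dom f);
     iweak := fun w A => bwd (phi0 F) ∘ fmap F (iweak M w A) ∘ phi_ty F M A;
     iexch := fun e n s A =>
       bwd (phi_ty F M A) ∘ fmap F (iexch M e s A) ∘ phi_ty F M (permute s A);
     icontr := fun c A =>
       bwd (phi_ty F M (A ++ A)) ∘ fmap F (icontr M c A) ∘ phi_ty F M A |}.

Lemma phi_ty_cat (T : Type) (C D : MonCat) (F : SMFunctor C D) (ob : T -> C)
    (A B : seq T) :
  fmap F (ty_cat ob A B) ∘ phi_ty F ob (A ++ B) =
  phi F (ty ob A) (ty ob B) ∘ (phi_ty F ob A ⊠ phi_ty F ob B) ∘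
    ty_cat (fun a => F (ob a)) A B.
Proof.
elim: A => [|a A IH] /=.
  apply: (iso_mono (i := fmap_iso F (lunit (ty ob B)))) => /=.
  rewrite !compmA -fmapM bwdK fmap1 comp1m.
  have -> : phi0 F ⊠ phi_ty F ob B =
      (phi0 F ⊠ idm _) ∘ (idm munit ⊠ phi_ty F ob B).
    by rewrite -tensmM comp1m compm1.
  by rewrite compmA phi_lunit lunit_nat -compmA bwdK compm1.
apply: (iso_mono (i := fmap_iso F (assoc (ob a) (ty ob A) (ty ob B)))) => /=.
rewrite !compmA -fmapM compmA bwdK comp1m.
have -> : (phi F (ob a) (ty ob A) ∘ (idm (F (ob a)) ⊠ phi_ty F ob A))
      ⊠ phi_ty F ob B =
    (phi F (ob a) (ty ob A) ⊠ idm _) ∘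
    ((idm (F (ob a)) ⊠ phi_ty F ob A) ⊠ phi_ty F ob B).
  by rewrite -tensmM comp1m.
rewrite !compmA phi_assoc.
rewrite -[in RHS](compmA _ (assoc _ _ _)) assoc_nat !compmA.
rewrite -[in RHS](compmA _ (assoc _ _ _)) bwdK compm1.
rewrite -phi_nat fmap1 -!compmA; congr (_ ∘ _).
by rewrite -!tensmM !comp1m IH !compmA.
Qed.

Lemma phi_ty_tens (T : Type) (C D : MonCat) (F : SMFunctor C D) (ob : T -> C)
    (A B A' B' : seq T)
    (f : hom (ty ob A) (ty ob B)) (g : hom (ty ob A') (ty ob B'))
    (f' : hom (ty (fun a => F (ob a)) A) (ty (fun a => F (ob a)) B))
    (g' : hom (ty (fun a => F (ob a)) A') (ty (fun a => F (ob a)) B')) :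
  phi_ty F ob B ∘ f' = fmap F f ∘ phi_ty F ob A ->
  phi_ty F ob B' ∘ g' = fmap F g ∘ phi_ty F ob A' ->
  phi_ty F ob (B ++ B') ∘ ty_tens f' g' =
  fmap F (ty_tens f g) ∘ phi_ty F ob (A ++ A').
Proof.
move=> ef eg; rewrite /ty_tens.
apply: (iso_mono (i := fmap_iso F (ty_cat ob B B'))) => /=.
rewrite !compmA -fmapM !compmA bwdK comp1m.
rewrite phi_ty_cat -(compmA _ (ty_cat _ _ _)) bwdK compm1.
rewrite -(compmA _ (_ ⊠ _) (_ ⊠ _)) -tensmM ef eg tensmM !compmA phi_nat.
by rewrite fmapM -!compmA phi_ty_cat !compmA.
Qed.

Lemma phi_ty_id (T : Type) (C D : MonCat) (F : SMFunctor C D) (ob : T -> C)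
    (A : seq T) :
  phi_ty F ob A ∘ idm _ = fmap F (idm (ty ob A)) ∘ phi_ty F ob A.
Proof. by rewrite compm1 fmap1 comp1m. Qed.

Lemma phi_ty_comp (T : Type) (C D : MonCat) (F : SMFunctor C D) (ob : T -> C)
    (A B A' : seq T)
    (f : hom (ty ob A) (ty ob B)) (g : hom (ty ob B) (ty ob A'))
    (f' : hom (ty (fun a => F (ob a)) A) (ty (fun a => F (ob a)) B))
    (g' : hom (ty (fun a => F (ob a)) B) (ty (fun a => F (ob a)) A')) :
  phi_ty F ob B ∘ f' = fmap F f ∘ phi_ty F ob A ->
  phi_ty F ob A' ∘ g' = fmap F g ∘ phi_ty F ob B ->
  phi_ty F ob A' ∘ (g' ∘ f') = fmap F (g ∘ f) ∘ phi_ty F ob A.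
Proof. by move=> ef eg; rewrite compmA eg -compmA ef compmA -fmapM. Qed.

Lemma interp_push (L : language) (C D : MonCat) (F : SMFunctor C D)
    (M : prestructure L C) x A t B (d : deriv x A t B) :
  phi_ty F M B ∘ interp (push_pre F M) d = fmap F (interp M d) ∘ phi_ty F M A.
Proof.
move: x A t B d.
apply: (@deriv_mut L
  (fun x A t B d => phi_ty F M B ∘ interp (push_pre F M) d =
     fmap F (interp M d) ∘ phi_ty F M A)
  (fun x A t B d => phi_ty F M B ∘ interps (push_pre F M) d =
     fmap F (interps M d) ∘ phi_ty F M A)).
- by move=> x A; apply: phi_ty_id.
- move=> f x A t u ds IH /=.
  apply: (iso_mono (i := fmap_iso F (runit (M (cod f))))) => /=.
  rewrite !compmA -fmapM !compmA bwdK comp1m phi_runit bwdK comp1m.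
  by rewrite fmapM -!compmA IH.
- by move=> x A s B y t E d1 IH1 d2 IH2 /=; apply: phi_ty_comp.
- exact: phi_ty_id.
- by move=> x A s B y E t E1 u d1 IH1 d2 IH2 /=; apply: phi_ty_tens.
- move=> x1 x2 x3 A1 A2 A3 t B w u s1 s2 d IH /=.
  apply: phi_ty_comp => //.
  apply: (phi_ty_tens (B := A1) (B' := A3)); first exact: phi_ty_id.
  apply: (phi_ty_tens (B := [::]) (B' := A3)); last exact: phi_ty_id.
  by rewrite /= !compmA bwdK comp1m.
- move=> n s x A t B e d IH /=; apply: phi_ty_comp IH.
  by rewrite !compmA bwdK comp1m.
- move=> x1 x x' x2 A1 A A2 t B c s1 s s' d IH /=.
  apply: phi_ty_comp IH.
  apply: phi_ty_tens; first exact: phi_ty_id.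
  apply: phi_ty_tens; last exact: phi_ty_id.
  by rewrite /= !compmA bwdK comp1m.
- exact: phi_ty_id.
- move=> x A t B xs As ts Bs d IH ds IHs /=.
  exact: (phi_ty_tens (B := [:: B])).
Qed.

Program Definition push_str (L : language) (C D : MonCat) (F : SMFunctor C D)
    (M : structure L C) : structure L D :=
  {| prestr := push_pre F M |}.
Next Obligation.
apply: (iso_mono (i := phi_ty F M B)).
by rewrite !interp_push (interp_irrel M d d').
Qed.

Lemma push_sat (Th : theory) (C D : MonCat) (F : SMFunctor C D)
    (M : model Th C) (e : formula Th) :
  axioms e -> satisfies (push_str F M) e.
Proof.
move=> ax d d'; apply: (iso_mono (i := phi_ty F M (fcod e))).
by rewrite /= !interp_push (sat M ax d d').
Qed.

Definition push (Th : theory) (C D : MonCat) (F : SMFunctor C D)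
    (M : model Th C) : model Th D :=
  {| str := push_str F M; sat := @push_sat Th C D F M |}.

Lemma phi_ty_hom (T : Type) (C D : MonCat) (F : SMFunctor C D) (o o' : T -> C)
    (h : forall a, hom (o a) (o' a)) (A : seq T) :
  phi_ty F o' A ∘ ty_hom (fun a => fmap F (h a)) A =
  fmap F (ty_hom h A) ∘ phi_ty F o A.
Proof.
elim: A => [|a A IH] /=; first by rewrite compm1 fmap1 comp1m.
rewrite compmA -phi_nat -!compmA -!tensmM; congr (_ ∘ (_ ⊠ _)) => //.
by rewrite compm1 comp1m.
Qed.

Program Definition push_mor (Th : theory) (C D : MonCat) (F : SMFunctor C D)
    (M N : Mod Th C) (h : hom M N) :
    @hom (Mod Th D) (push F M) (push F N) :=
  {| smor := fun a => fmap F (smor h a) |}.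
Next Obligation.
apply: (iso_mono (i := phi_ty F N B)) => /=.
rewrite !compmA phi_ty_hom interp_push -!compmA interp_push phi_ty_hom.
by rewrite !compmA -!fmapM smor_interp.
Qed.

Program Definition Mod_map (Th : theory) (C D : MonCat) (F : SMFunctor C D) :
    Functor (Mod Th C) (Mod Th D) :=
  {| fobj := push F : Mod Th C -> Mod Th D; fmap := push_mor F |}.
Next Obligation. by apply: str_mor_ext => a /=; rewrite fmap1. Qed.
Next Obligation. by apply: str_mor_ext => a /=; rewrite fmapM. Qed.

Lemma phi_ty_mt (T : Type) (C D : MonCat) (F F' : SMFunctor C D)
    (q : MonTrans F F') (o : T -> C) (A : seq T) :
  phi_ty F' o A ∘ ty_hom (fun a => q (o a)) A = q (ty o A) ∘ phi_ty F o A.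
Proof.
elim: A => [|a A IH] /=; first by rewrite compm1 mt_phi0.
rewrite compmA mt_phi -!compmA -!tensmM; congr (_ ∘ (_ ⊠ _)) => //.
by rewrite compm1 comp1m.
Qed.

Program Definition Mod_trans (Th : theory) (C D : MonCat)
    (F F' : SMFunctor C D) (q : MonTrans F F') (M : Mod Th C) :
    hom (Mod_map Th F M) (Mod_map Th F' M) :=
  {| smor := fun a => q (ob (prestr (str M)) a) |}.
Next Obligation.
apply: (iso_mono (i := phi_ty F' M B)) => /=.
rewrite !compmA phi_ty_mt interp_push -!compmA interp_push phi_ty_mt.
by rewrite !compmA mt_nat.
Qed.

(* 2-naturality of E : hom(T, -) -> Mod(Th, -): the squares for the functors F
   commute on the nose, and the components of the transformations q agree
   modulo these equalities of models. *)
Definition is_natural (Th : theory) (T : MonCat)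
    (E : forall C : MonCat, Functor (Hom T C) (Mod Th C)) : Prop :=
  (forall (C D : MonCat) (F : SMFunctor C D),
     functor_comp (Mod_map Th F) (E C) = functor_comp (E D) (Hom_map T F)) /\
  (forall (C D : MonCat) (F F' : SMFunctor C D) (q : MonTrans F F')
     (G : Hom T C)
     (e : Mod_map Th F (E C G) = E D (sm_comp F G))
     (e' : Mod_map Th F' (E C G) = E D (sm_comp F' G)),
     eq_mor e' ∘ Mod_trans q (E C G) = fmap (E D) (whiskerr q G) ∘ eq_mor e).

(* Main.v *)
From mathcomp Require Import all_boot perm.
From Stdlib Require Import FunctionalExtensionality ProofIrrelevance.
Require Import Defs.
From Stdlib Require Import PropExtensionality IndefiniteDescription.

(** The classifying category has binary trees of atomic types as objects, and
    as arrows the formal monoidal expressions over the functional constants and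
    the structural rules, two expressions being identified when they take the
    same value in all models in all monoidal categories. Since equality is
    semantic, every identity that holds in all models (the axioms of a monoidal
    category, independence of derivations, the axioms of the theory) holds
    automatically, so the generators form a generic model U, and
    G |-> G(U) has as quasi-inverse the functor sending a model M to evaluation
    of expressions in M. That a morphism of models induces a natural
    transformation between evaluations uses that each generator is,
    up to coherence, the interpretation of some derivation. *)

Set Implicit Arguments.
Unset Strict Implicit.
Unset Printing Implicit Defensive.

Local Open Scope cat_scope.
Local Obligation Tactic := intros; simpl.

(** * Coherence of the inserted isomorphisms with tensors and units *)

Lemma iso_swap (C : Category) (x y x' y' : C) (i : iso x y) (j : iso x' y')
    (f : hom x x') (g : hom y y') :
  j ∘ f = g ∘ i -> f ∘ bwd i = bwd j ∘ g.
Proof.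
move=> E; apply: (iso_mono (i := j)); apply: (iso_epi (i := i)).
by rewrite !compmA bwdK comp1m -compmA fwdK compm1.
Qed.

Lemma tensm_idr_inj (C : MonCat) (x y : C) (f g : hom x y) :
  f ⊠ idm munit = g ⊠ idm munit -> f = g.
Proof.
by move=> e; apply: (iso_epi (i := runit x)); rewrite -!runit_nat e.
Qed.

Lemma ty_tens_id (T : Type) (C : MonCat) (ob : T -> C) (A B : seq T) :
  ty_tens (idm (ty ob A)) (idm (ty ob B)) = idm (ty ob (A ++ B)).
Proof. by rewrite /ty_tens tensm1 compm1 fwdK. Qed.

Lemma ty_tens_nil (T : Type) (C : MonCat) (ob : T -> C) (A B : seq T)
    (f : hom (ty ob A) (ty ob B)) :
  ty_tens (A := [::]) (B := [::]) (idm munit) f = f.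
Proof. by rewrite /ty_tens /= lunit_nat -compmA bwdK compm1. Qed.

Lemma ty_hom_cat (T : Type) (C : MonCat) (ob ob' : T -> C)
    (h : forall a, hom (ob a) (ob' a)) (A B : seq T) :
  ty_cat ob' A B ∘ ty_hom h (A ++ B) =
  (ty_hom h A ⊠ ty_hom h B) ∘ ty_cat ob A B.
Proof.
elim: A => [|a A IH] /=.
  apply: (iso_mono (i := lunit (ty ob' B))).
  by rewrite !compmA bwdK comp1m lunit_nat -compmA bwdK compm1.
apply: (iso_mono (i := assoc (ob' a) (ty ob' A) (ty ob' B))).
rewrite !compmA bwdK comp1m assoc_nat -(compmA _ (fwd (assoc _ _ _))).
by rewrite bwdK compm1 -!tensmM IH compm1 comp1m.
Qed.

(** Tensoring with the unit is faithful, since [runit] is a natural isomorphism. This strips the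
    empty right-hand context that [interp] inserts in weakening and contraction, where [A ++ [::]]
    does not compute to [A]. *)
Lemma ty_hom_tensr_nil (T : Type) (C : MonCat) (ob ob' : T -> C)
    (h : forall a, hom (ob a) (ob' a)) (A B : seq T)
    (f : hom (ty ob A) (ty ob B)) (f' : hom (ty ob' A) (ty ob' B)) :
  ty_hom h (B ++ [::]) ∘ ty_tens (A' := [::]) (B' := [::]) f (idm munit) =
  ty_tens (A' := [::]) (B' := [::]) f' (idm munit) ∘ ty_hom h (A ++ [::]) ->
  ty_hom h B ∘ f = f' ∘ ty_hom h A.
Proof.
move=> e; apply: tensm_idr_inj; apply: (iso_epi (i := ty_cat ob A [::])).
have /(congr1 (compm (ty_cat ob' B [::]))) := e.
rewrite /ty_tens !compmA bwdK comp1m ty_hom_cat.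
rewrite -(compmA _ (fwd (ty_cat ob' A [::]))) ty_hom_cat.
rewrite -(compmA _ (fwd (ty_cat ob B [::]))) bwdK compm1.
by rewrite !compmA -!tensmM /= !comp1m.
Qed.

(** * Morphisms of structures commute with the generating arrows *)

Lemma id_deriv (L : language) (x : seq nat) (A : seq (sort L)) :
  uniq x -> size x = size A ->
  exists t (d : deriv x A t A),
    forall (C : MonCat) (M : prestructure L C), interp M d = idm (ty M A).
Proof.
elim: A x => [|a A IH] [|v x] //; first by exists [::], (DUnit L).
move=> ux [sx]; have /andP [_ ux'] := ux; have [t [d e]] := IH x ux' sx.
exists ([:: Var v] ++ t), (DTens (x := [:: v]) ux (DVar v a) d) => C M /=.
by rewrite e (ty_tens_id _ [:: a]).
Qed.

Lemma id_derivs (L : language) (x : seq nat) (A : seq (sort L)) :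
  size x = size A ->
  exists t (d : derivs x A t A),
    forall (C : MonCat) (M : prestructure L C), interps M d = idm (ty M A).
Proof.
elim: A x => [|a A IH] [|v x] //; first by exists [::], (DNil L).
move=> [sx]; have [t [d e]] := IH x sx.
exists (Var v :: t), (DCons (DVar v a) d) => C M /=.
by rewrite e (ty_tens_id _ [:: a]).
Qed.

(** A morphism is only known to commute with interpretations of derivations, so [f] is applied to a
    list of variables, whose interpretation is an identity. The result lands in [ty] of a singleton,
    which carries an extra unit factor; hence the [runit] to cancel. *)
Lemma str_mor_op (L : language) (C : MonCat) (M N : prestructure L C)
    (h : str_mor M N) (f : op L) :
  h (cod f) ∘ iop M f = iop N f ∘ ty_hom h (dom f).
Proof.
have [t [d e]] := id_derivs (size_iota 0 (size (dom f))).
have := smor_interp h (DFun (iota_uniq _ _) d); rewrite /= !e !compm1 => E.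
apply: (iso_mono (i := iso_inv (runit (N (cod f))))) => /=.
rewrite [RHS]compmA -E !compmA; congr (_ ∘ _).
apply: (iso_mono (i := runit (N (cod f)))).
by rewrite !compmA bwdK comp1m runit_nat -compmA bwdK compm1.
Qed.

Lemma str_mor_weak (L : language) (C : MonCat) (M N : prestructure L C)
    (h : str_mor M N) (w : has_rule L Weakening) (A : seq (sort L)) :
  iweak M w A = iweak N w A ∘ ty_hom h A.
Proof.
(* Weakening the derivation of the empty term by all of [A] isolates [iweak], up to unit factors on
   both sides. *)
have u : uniq ([::] ++ iota 0 (size A) ++ [::]) by rewrite cats0 iota_uniq.
have := smor_interp h (DWeak (x1 := [::]) (x3 := [::]) (A1 := [::])
  (A3 := [::]) w u (erefl _) (size_iota _ _) (DUnit L)).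
rewrite /= !comp1m.
rewrite !(@ty_tens_nil _ _ _ (A ++ [::]) [::]) => E.
rewrite -[LHS]comp1m; apply: (@ty_hom_tensr_nil _ _ _ _ h A [::]).
by rewrite /= comp1m.
Qed.

Lemma str_mor_exch (L : language) (C : MonCat) (M N : prestructure L C)
    (h : str_mor M N) (w : has_rule L Exchange) n (s : 'S_n)
    (A : n.-tuple (sort L)) :
  ty_hom h A ∘ iexch M w s A = iexch N w s A ∘ ty_hom h (permute s A).
Proof.
have sx : size (iota_tuple n 0) = size A by rewrite !size_tuple.
have [t [d e]] := id_deriv (iota_uniq 0 n) sx.
by have := smor_interp h (DExch s w d); rewrite /= !e !comp1m.
Qed.

Lemma str_mor_contr (L : language) (C : MonCat) (M N : prestructure L C)
    (h : str_mor M N) (w : has_rule L Contraction) (A : seq (sort L)) :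
  ty_hom h (A ++ A) ∘ icontr M w A = icontr N w A ∘ ty_hom h A.
Proof.
(* Two consecutive blocks of numbers serve as disjoint lists of variables for the two copies of
   [A]. *)
set x := iota 0 (size A); set x' := iota (size A) (size A).
have u : uniq ([::] ++ (x ++ x') ++ [::]).
  by rewrite cats0 /x /x' -{2}[size A]add0n -iotaD iota_uniq.
have sx : size ([::] ++ (x ++ x') ++ [::]) = size ([::] ++ (A ++ A) ++ [::]).
  by rewrite !size_cat !size_iota.
have [t [d e]] := id_deriv u sx.
have := smor_interp h (DContr (x1 := [::]) (x2 := [::]) (A1 := [::])
  (A2 := [::]) w (erefl _) (size_iota _ _) (size_iota _ _) d).
rewrite /= !e !comp1m.
rewrite !(@ty_tens_nil _ _ _ (A ++ [::]) ((A ++ A) ++ [::])).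
exact: (@ty_hom_tensr_nil _ _ _ _ h A (A ++ A)).
Qed.

(** * Trees of atomic types and formal monoidal expressions *)

Inductive tobj (T : Type) : Type :=
| TUnit
| TAtom of T
| TTens of tobj T & tobj T.
Arguments TUnit {T}.

(** The bracketing copies that of [ty], so that [ty] for the generic prestructure is [tty] by
    computation. *)
Definition tty (T : Type) (A : seq T) : tobj T :=
  foldr (fun a X => TTens (TAtom a) X) TUnit A.

Fixpoint oint (T : Type) (C : MonCat) (ob : T -> C) (o : tobj T) : C :=
  match o with
  | TUnit => munit
  | TAtom a => ob a
  | TTens o p => oint ob o ⊗ oint ob p
  end.

Fixpoint ohom (T : Type) (C : MonCat) (ob ob' : T -> C)
    (h : forall a, hom (ob a) (ob' a)) (o : tobj T) :
    hom (oint ob o) (oint ob' o) :=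
  match o with
  | TUnit => idm munit
  | TAtom a => h a
  | TTens o p => ohom h o ⊠ ohom h p
  end.

(** The two objects are equal, but only by induction on [A]; this isomorphism, assembled from
    identities, replaces a transport along that equality. *)
Fixpoint tty_iso (T : Type) (C : MonCat) (ob : T -> C) (A : seq T) :
    iso (ty ob A) (oint ob (tty A)) :=
  match A with
  | [::] => iso_id munit
  | a :: A' => tens_iso (iso_id (ob a)) (tty_iso ob A')
  end.

Lemma ohom_tty (T : Type) (C : MonCat) (ob ob' : T -> C)
    (h : forall a, hom (ob a) (ob' a)) (A : seq T) :
  ohom h (tty A) ∘ tty_iso ob A = tty_iso ob' A ∘ ty_hom h A.
Proof.
by elim: A => [|a A IH] //=; rewrite -!tensmM IH comp1m compm1.
Qed.

Lemma ohom_ttyV (T : Type) (C : MonCat) (ob ob' : T -> C)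
    (h : forall a, hom (ob a) (ob' a)) (A : seq T) :
  ty_hom h A ∘ bwd (tty_iso ob A) = bwd (tty_iso ob' A) ∘ ohom h (tty A).
Proof.
by apply: iso_swap; rewrite ohom_tty.
Qed.

Lemma ohom1 (T : Type) (C : MonCat) (ob : T -> C) (o : tobj T) :
  ohom (fun a => idm (ob a)) o = idm (oint ob o).
Proof. by elim: o => //= o -> p ->; rewrite tensm1. Qed.

Lemma ohomM (T : Type) (C : MonCat) (o1 o2 o3 : T -> C)
    (k : forall a, hom (o2 a) (o3 a)) (h : forall a, hom (o1 a) (o2 a))
    (o : tobj T) :
  ohom (fun a => k a ∘ h a) o = ohom k o ∘ ohom h o.
Proof. by elim: o => [|a|o /= -> p ->]; rewrite ?comp1m ?tensmM. Qed.

Inductive expr (L : language) : tobj (sort L) -> tobj (sort L) -> Type :=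
| EId o : expr o o
| EComp o p q : expr p q -> expr o p -> expr o q
| ETens o p o' p' : expr o o' -> expr p p' -> expr (TTens o p) (TTens o' p')
| EAssoc o p q : expr (TTens (TTens o p) q) (TTens o (TTens p q))
| EAssocV o p q : expr (TTens o (TTens p q)) (TTens (TTens o p) q)
| ELunit o : expr (TTens TUnit o) o
| ELunitV o : expr o (TTens TUnit o)
| ERunit o : expr (TTens o TUnit) o
| ERunitV o : expr o (TTens o TUnit)
| EOp (f : op L) : expr (tty (dom f)) (TAtom (cod f))
| EWeak (w : has_rule L Weakening) (A : seq (sort L)) : expr (tty A) TUnit
| EExch (w : has_rule L Exchange) n (s : 'S_n) (A : n.-tuple (sort L)) :
    expr (tty (permute s A)) (tty A)
| EContr (w : has_rule L Contraction) (A : seq (sort L)) :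
    expr (tty A) (tty (A ++ A)).

Fixpoint eval (L : language) (C : MonCat) (M : prestructure L C) o p
    (e : expr o p) : hom (oint M o) (oint M p) :=
  match e in expr o p return hom (oint M o) (oint M p) with
  | EId o => idm (oint M o)
  | EComp _ _ _ e1 e2 => eval M e1 ∘ eval M e2
  | ETens _ _ _ _ e1 e2 => eval M e1 ⊠ eval M e2
  | EAssoc o p q => assoc (oint M o) (oint M p) (oint M q)
  | EAssocV o p q => bwd (assoc (oint M o) (oint M p) (oint M q))
  | ELunit o => lunit (oint M o)
  | ELunitV o => bwd (lunit (oint M o))
  | ERunit o => runit (oint M o)
  | ERunitV o => bwd (runit (oint M o))
  | EOp f => iop M f ∘ bwd (tty_iso M (dom f))
  | EWeak w A => iweak M w A ∘ bwd (tty_iso M A)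
  | EExch w _ s A =>
      tty_iso M A ∘ iexch M w s A ∘ bwd (tty_iso M (permute s A))
  | EContr w A => tty_iso M (A ++ A) ∘ icontr M w A ∘ bwd (tty_iso M A)
  end.

(** Coherence generators commute with [h] by their own naturality, their inverses by [iso_swap], and
    the generators coming from the language by the [str_mor] lemmas. *)
Lemma eval_nat (L : language) (C : MonCat) (M N : prestructure L C)
    (h : str_mor M N) o p (e : expr o p) :
  ohom h p ∘ eval M e = eval N e ∘ ohom h o.
Proof.
elim: o p / e => /= [o|o p q e1 IH1 e2 IH2|o p o' p' e1 IH1 e2 IH2|o p q|o p q|
  o|o|o|o|f|w A|w n s A|w A].
- by rewrite comp1m compm1.
- by rewrite compmA IH1 -compmA IH2 compmA.
- by rewrite -!tensmM IH1 IH2.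
- by rewrite assoc_nat.
- by apply: iso_swap; rewrite assoc_nat.
- by rewrite lunit_nat.
- by apply: iso_swap; rewrite lunit_nat.
- by rewrite runit_nat.
- by apply: iso_swap; rewrite runit_nat.
- by rewrite compmA str_mor_op -!compmA ohom_ttyV.
- by rewrite comp1m (str_mor_weak h) -!compmA ohom_ttyV.
- rewrite !compmA ohom_tty -[_ ∘ _ ∘ iexch _ _ _ _]compmA str_mor_exch.
  by rewrite -!compmA ohom_ttyV.
- rewrite !compmA ohom_tty -[_ ∘ _ ∘ icontr _ _ _]compmA str_mor_contr.
  by rewrite -!compmA ohom_ttyV.
Qed.

(** * Semantic equality and the classifying category *)

Definition equiv (Th : theory) o p (e e' : @expr Th o p) : Prop :=
  forall (C : MonCat) (M : model Th C), eval M e = eval M e'.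

(* A chosen representative of the class of [e]; arrows of the classifying
   category are the expressions equal to their representative. *)
Definition canon (Th : theory) o p (e : @expr Th o p) : @expr Th o p :=
  sval (constructive_indefinite_description (equiv e)
    (ex_intro (equiv e) e (fun _ _ => erefl))).
Arguments canon : simpl never.

Lemma eval_canon (Th : theory) o p (e : @expr Th o p) (C : MonCat)
    (M : model Th C) :
  eval M (canon e) = eval M e.
Proof. by rewrite /canon; case: constructive_indefinite_description. Qed.

(** Equivalent expressions have equal predicates [equiv e] by extensionality, and choice applied to
    equal predicates returns the same witness once the existence proofs are identified. *)
Lemma canon_eq (Th : theory) o p (e e' : @expr Th o p) :
  equiv e e' -> canon e = canon e'.
Proof.
move=> E; have eP : equiv e = equiv e'.
  apply: functional_extensionality => k; apply: propositional_extensionality.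
  by split=> k' C M; [rewrite -E | rewrite E].
rewrite /canon; move: (ex_intro (equiv e) _ _) (ex_intro (equiv e') _ _).
by rewrite eP => p1 p2; rewrite (proof_irrelevance _ p1 p2).
Qed.

(** As [equiv] is a proposition, its quantification over all monoidal categories does not raise the
    universe of these hom types. *)
Definition thom (Th : theory) (o p : tobj (sort Th)) : Type :=
  {e : @expr Th o p | canon e = e}.

Definition cls (Th : theory) o p (e : @expr Th o p) : thom o p :=
  exist _ (canon e) (canon_eq (fun C M => eval_canon e M)).

(** Reduces each law of the classifying category to the same law in the target of an arbitrary
    model. *)
Lemma thom_ext (Th : theory) o p (q q' : @thom Th o p) :
  (forall (C : MonCat) (M : model Th C),
     eval M (sval q) = eval M (sval q')) ->
  q = q'.
Proof.
case: q q' => [e E] [e' E'] /= /canon_eq; rewrite E E' => ee'; subst e'.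
by rewrite (proof_irrelevance _ E E').
Qed.

Lemma cls_sval (Th : theory) o p (q : @thom Th o p) : cls (sval q) = q.
Proof. by apply: thom_ext => C M; rewrite eval_canon. Qed.

(** Arrows compose through their representatives, while inductions on expressions meet raw
    subexpressions; this passes between the two. *)
Lemma cls_comp (Th : theory) o p q (e : @expr Th p q) (e' : @expr Th o p) :
  cls (EComp (canon e) (canon e')) = cls (EComp e e').
Proof. by apply: thom_ext => C M; rewrite /= !eval_canon /= !eval_canon. Qed.

Lemma cls_tens (Th : theory) o o' p p' (e : @expr Th o o')
    (e' : @expr Th p p') :
  cls (ETens (canon e) (canon e')) = cls (ETens e e').
Proof. by apply: thom_ext => C M; rewrite /= !eval_canon /= !eval_canon. Qed.

Program Definition term_category (Th : theory) : Category :=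
  {| obj := tobj (sort Th); hom := @thom Th;
     idm := fun o => cls (EId o);
     compm := fun o p q g f => cls (EComp (sval g) (sval f)) |}.
Next Obligation.
by apply: thom_ext => C M; rewrite /= !eval_canon /= !eval_canon comp1m.
Qed.
Next Obligation.
by apply: thom_ext => C M; rewrite /= !eval_canon /= !eval_canon compm1.
Qed.
Next Obligation.
by apply: thom_ext => C M; rewrite /= !eval_canon /= !eval_canon compmA.
Qed.

Program Definition term_iso (Th : theory) (o p : term_category Th)
    (e : @expr Th o p) (e' : @expr Th p o)
    (K : forall (C : MonCat) (M : model Th C),
       eval M e' ∘ eval M e = idm _ /\ eval M e ∘ eval M e' = idm _) :
    iso o p :=
  {| fwd := cls e : hom o p; bwd := cls e' : hom p o |}.
Next Obligation.
apply: thom_ext => C M; rewrite /= !eval_canon /= !eval_canon.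
by case: (K C M).
Qed.
Next Obligation.
apply: thom_ext => C M; rewrite /= !eval_canon /= !eval_canon.
by case: (K C M).
Qed.

Program Definition classifying (Th : theory) : MonCat :=
  {| mcat := term_category Th; munit := TUnit; tens := @TTens _;
     tensm := fun o p o' p' f g => cls (ETens (sval f) (sval g));
     assoc := fun o p q =>
       term_iso (e := EAssoc o p q) (e' := EAssocV o p q)
         (fun C M => conj (fwdK _) (bwdK _));
     lunit := fun o =>
       term_iso (e := ELunit o) (e' := ELunitV o)
         (fun C M => conj (fwdK _) (bwdK _));
     runit := fun o =>
       term_iso (e := ERunit o) (e' := ERunitV o)
         (fun C M => conj (fwdK _) (bwdK _)) |}.
Next Obligation.
by apply: thom_ext => C M; rewrite /= !eval_canon /= !eval_canon /= tensm1.
Qed.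
Next Obligation.
by apply: thom_ext => C M; do !rewrite /= !eval_canon; rewrite tensmM.
Qed.
Next Obligation.
by apply: thom_ext => C M; do !rewrite /= !eval_canon; rewrite assoc_nat.
Qed.
Next Obligation.
by apply: thom_ext => C M; do !rewrite /= !eval_canon; rewrite lunit_nat.
Qed.
Next Obligation.
by apply: thom_ext => C M; do !rewrite /= !eval_canon; rewrite runit_nat.
Qed.
Next Obligation.
by apply: thom_ext => C M; do !rewrite /= !eval_canon; rewrite pentagon.
Qed.
Next Obligation.
by apply: thom_ext => C M; do !rewrite /= !eval_canon; rewrite triangle.
Qed.

(** * Evaluation in a model, and the generic model *)

Program Definition eval_functor (Th : theory) (C : MonCat) (M : model Th C) :
    Functor (classifying Th) C :=
  {| fobj := oint M : classifying Th -> C;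
     fmap := fun o p q => eval M (sval q) |}.
Next Obligation. by rewrite eval_canon. Qed.
Next Obligation. by rewrite eval_canon. Qed.

(** Since objects are trees, [oint] preserves tensor and unit by computation, so the structure
    isomorphisms can be identities. *)
Program Definition eval_sm (Th : theory) (C : MonCat) (M : model Th C) :
    SMFunctor (classifying Th) C :=
  {| smf := eval_functor M;
     phi := fun o p => iso_id _; phi0 := iso_id _ |}.
Next Obligation. by rewrite eval_canon /= comp1m compm1. Qed.
Next Obligation. by rewrite eval_canon /= !tensm1 !compm1 !comp1m. Qed.
Next Obligation. by rewrite eval_canon /= !tensm1 !compm1. Qed.
Next Obligation. by rewrite eval_canon /= !tensm1 !compm1. Qed.

Definition generic_pre (Th : theory) : prestructure Th (classifying Th) :=
  {| ob := @TAtom _ : sort Th -> classifying Th;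
     iop := fun f => cls (EOp f);
     iweak := fun w A => cls (EWeak w A);
     iexch := fun w n s A => cls (EExch w s A);
     icontr := fun w A => cls (EContr w A) |}.

Lemma phi_ty_eval (Th : theory) (C : MonCat) (M : model Th C)
    (A : seq (sort Th)) :
  phi_ty (eval_sm M) (generic_pre Th) A = tty_iso M A.
Proof.
elim: A => [|a A IH] /=; apply: iso_ext => //=; by rewrite comp1m IH.
Qed.

(** The first premise, proved by reflexivity in the uses below, retypes the fields of [N] over
    [ob M], so that they are compared without transport. *)
Lemma prestructure_ext (L : language) (C : MonCat) (M N : prestructure L C)
    io iw ie ic :
  N = {| ob := ob M; iop := io; iweak := iw; iexch := ie; icontr := ic |} ->
  (forall f, io f = iop M f) ->
  (forall w A, iw w A = iweak M w A) ->
  (forall w n (s : 'S_n) A, ie w n s A = iexch M w s A) ->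
  (forall w A, ic w A = icontr M w A) ->
  N = M.
Proof.
move=> ->; case: M io iw ie ic => ob io' iw' ie' ic' /= io iw ie ic eo ew ee ec.
have -> : io = io' by apply: functional_extensionality_dep.
have -> : iw = iw' by do 2!apply: functional_extensionality_dep => ?.
have -> : ie = ie' by do 4!apply: functional_extensionality_dep => ?.
by have -> : ic = ic' by do 2!apply: functional_extensionality_dep => ?.
Qed.

(** A strict equality: the [tty_iso] inserted by [eval] cancel against the coherence isomorphisms
    inserted by [push_pre]. *)
Lemma push_eval_generic (Th : theory) (C : MonCat) (M : model Th C) :
  push_pre (eval_sm M) (generic_pre Th) = M.
Proof.
have pe := phi_ty_eval M; simpl in pe.
apply: prestructure_ext => // [f|w A|w n s A|w A] /=;
  by rewrite eval_canon /= !pe ?comp1m -?compmA fwdK compm1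
    ?compmA ?fwdK ?comp1m.
Qed.

(** Arrows are tested by evaluation in each [M]; [interp_push] and [push_eval_generic] turn the test
    into an equality of interpretations in [M]. Allowing two terms covers both independence of
    derivations and the axioms. *)
Lemma interp_generic (Th : theory) x A t B s
    (d : deriv x A t B) (d' : deriv x A s B) :
  (forall (C : MonCat) (M : model Th C), interp M d = interp M d') ->
  interp (generic_pre Th) d = interp (generic_pre Th) d'.
Proof.
move=> E; apply: thom_ext => C M.
apply: (iso_epi (i := phi_ty (eval_sm M) (generic_pre Th) A)).
rewrite -!(interp_push (eval_sm M)); congr (_ ∘ _).
by have := E C M; rewrite -(push_eval_generic M).
Qed.

Program Definition generic_structure (Th : theory) :
    structure Th (classifying Th) :=
  {| prestr := generic_pre Th |}.
Next Obligation. by apply: interp_generic => C M; apply: interp_irrel. Qed.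

Lemma generic_sat (Th : theory) (e : formula Th) :
  axioms e -> satisfies (generic_structure Th) e.
Proof. by move=> ax d d'; apply: interp_generic => C M; apply: sat ax _ _. Qed.

Definition generic_model (Th : theory) : model Th (classifying Th) :=
  {| str := generic_structure Th; sat := @generic_sat Th |}.

(** * The comparison functors in both directions *)

Program Definition classify (Th : theory) (C : MonCat) :
    Functor (Hom (classifying Th) C) (Mod Th C) :=
  {| fobj := fun G => push G (generic_model Th) : Mod Th C;
     fmap := fun G G' a => Mod_trans a (generic_model Th) |}.
Next Obligation. by apply: str_mor_ext. Qed.
Next Obligation. by apply: str_mor_ext. Qed.

Program Definition eval_trans (Th : theory) (C : MonCat) (M N : Mod Th C)
    (h : hom M N) : MonTrans (eval_sm M) (eval_sm N) :=
  {| mt := fun o : classifying Th => ohom h o |}.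
Next Obligation. exact: eval_nat. Qed.
Next Obligation. by rewrite comp1m compm1. Qed.
Next Obligation. by rewrite comp1m. Qed.

Program Definition eval_classify (Th : theory) (C : MonCat) :
    Functor (Mod Th C) (Hom (classifying Th) C) :=
  {| fobj := @eval_sm Th C : Mod Th C -> Hom (classifying Th) C;
     fmap := @eval_trans Th C |}.
Next Obligation. by apply: MonTrans_ext => o /=; rewrite ohom1. Qed.
Next Obligation. by apply: MonTrans_ext => o /=; rewrite ohomM. Qed.

(** * The two natural isomorphisms and the equivalence *)

Program Definition mt_inv (C D : MonCat) (F G : SMFunctor C D)
    (i : forall x : C, iso (F x) (G x)) (a : MonTrans F G)
    (E : forall x, a x = i x) : MonTrans G F :=
  {| mt := fun x => bwd (i x) |}.
Next Obligation.
apply: (iso_mono (i := i y)); apply: (iso_epi (i := i x)).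
by rewrite !compmA bwdK comp1m -[_ ∘ _ ∘ i x]compmA fwdK compm1 -!E mt_nat.
Qed.
Next Obligation.
apply: (iso_mono (i := i (x ⊗ y))).
apply: (iso_epi (i := tens_iso (i x) (i y))).
rewrite /= !compmA bwdK comp1m -[_ ∘ _ ∘ (_ ⊠ _)]compmA -tensmM.
by rewrite !fwdK tensm1 compm1 -!E mt_phi.
Qed.
Next Obligation. by rewrite -(mt_phi0 a) E compmA fwdK comp1m. Qed.

Program Definition mt_iso (C D : MonCat) (F G : SMFunctor C D)
    (i : forall x : C, iso (F x) (G x)) (a : MonTrans F G)
    (E : forall x, a x = i x) : @iso (Hom C D) F G :=
  {| fwd := a : @hom (Hom C D) F G; bwd := mt_inv E |}.
Next Obligation. by apply: MonTrans_ext => x /=; rewrite E fwdK. Qed.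
Next Obligation. by apply: MonTrans_ext => x /=; rewrite E bwdK. Qed.

(** A strong monoidal functor is determined on trees, up to its structure isomorphisms, by its
    values on atoms. *)
Fixpoint sm_eval_iso (Th : theory) (C : MonCat)
    (G : SMFunctor (classifying Th) C) (o : tobj (sort Th)) :
    iso (oint (fun a => G (TAtom a)) o) (G o) :=
  match o with
  | TUnit => phi0 G
  | TAtom a => iso_id (G (TAtom a))
  | TTens o p =>
      iso_comp (phi G o p) (tens_iso (sm_eval_iso G o) (sm_eval_iso G p))
  end.

Lemma sm_eval_iso_tty (Th : theory) (C : MonCat)
    (G : SMFunctor (classifying Th) C) (A : seq (sort Th)) :
  sm_eval_iso G (tty A) ∘ tty_iso (fun a => G (TAtom a)) A =
  phi_ty G (generic_pre Th) A.
Proof.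
elim: A => [|a A IH] /=; first by rewrite compm1.
by rewrite -compmA -tensmM compm1 IH.
Qed.

Lemma sm_eval_iso_ttyV (Th : theory) (C : MonCat)
    (G : SMFunctor (classifying Th) C) (A : seq (sort Th)) :
  phi_ty G (generic_pre Th) A ∘ bwd (tty_iso (fun a => G (TAtom a)) A) =
  sm_eval_iso G (tty A).
Proof. by rewrite -sm_eval_iso_tty -compmA bwdK compm1. Qed.

(** The coherence generators are handled by the axioms of a strong monoidal functor; for the others,
    the corrections in [push_pre] cancel. Using raw expressions permits induction, and [cls_sval]
    then covers all arrows. *)
Lemma sm_eval_iso_nat (Th : theory) (C : MonCat)
    (G : SMFunctor (classifying Th) C) o p (e : @expr Th o p) :
  sm_eval_iso G p ∘ eval (push_pre G (generic_pre Th)) e =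
  fmap G (cls e : @hom (classifying Th) o p) ∘ sm_eval_iso G o.
Proof.
pose K := classifying Th; pose og := oint (fun a => G (TAtom a) : C).
(* The inverse coherence generators will follow from the forward ones. *)
have lift (x y : K) (i : iso x y) (g : iso (og x) (og y)) :
    sm_eval_iso G y ∘ g = fmap G i ∘ sm_eval_iso G x ->
    sm_eval_iso G x ∘ bwd g = fmap G (bwd i) ∘ sm_eval_iso G y.
  by move=> E; have := iso_swap (i := g) (j := fmap_iso G i) (esym E).
have Eassoc (q r s : K) :
    sm_eval_iso G (q ⊗ r ⊗ s) ∘ assoc (og q) (og r) (og s) =
    fmap G (assoc q r s) ∘ sm_eval_iso G ((q ⊗ r) ⊗ s).
  pose u := sm_eval_iso G.
  have splitr : u q ⊠ (phi G r s ∘ (u r ⊠ u s)) =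
      (idm _ ⊠ phi G r s) ∘ (u q ⊠ (u r ⊠ u s)).
    by rewrite -tensmM comp1m.
  have splitl : (phi G q r ∘ (u q ⊠ u r)) ⊠ u s =
      (phi G q r ⊠ idm _) ∘ ((u q ⊠ u r) ⊠ u s).
    by rewrite -tensmM comp1m.
  change (phi G q (r ⊗ s) ∘ (u q ⊠ (phi G r s ∘ (u r ⊠ u s))) ∘
      assoc (og q) (og r) (og s) =
    fmap G (assoc q r s) ∘
      (phi G (q ⊗ r) s ∘ ((phi G q r ∘ (u q ⊠ u r)) ⊠ u s))).
  by rewrite splitr splitl !compmA phi_assoc -!compmA assoc_nat.
have Elunit (q : K) : sm_eval_iso G q ∘ lunit (og q) =
    fmap G (lunit q) ∘ sm_eval_iso G (munit ⊗ q).
  rewrite -lunit_nat -phi_lunit /= -!compmA; congr (_ ∘ (_ ∘ _)).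
  by rewrite -tensmM comp1m compm1.
have Erunit (q : K) : sm_eval_iso G q ∘ runit (og q) =
    fmap G (runit q) ∘ sm_eval_iso G (q ⊗ munit).
  rewrite -runit_nat -phi_runit /= -!compmA; congr (_ ∘ (_ ∘ _)).
  by rewrite -tensmM comp1m compm1.
elim: o p / e => [o|o p q e1 IH1 e2 IH2|o p o' p' e1 IH1 e2 IH2|o p q|o p q|
  o|o|o|o|f|w A|w n s A|w A].
- by rewrite /= (fmap1 G) comp1m compm1.
- rewrite -cls_comp (fmapM G (cls e1 : @hom (classifying Th) _ _) (cls e2)) /=.
  by rewrite compmA IH1 -[LHS]compmA IH2 compmA.
- rewrite -cls_tens /= compmA.
  rewrite -(phi_nat G (cls e1 : @hom (classifying Th) _ _)
              (cls e2 : @hom (classifying Th) _ _)).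
  by rewrite -!compmA -!tensmM IH1 IH2.
- exact: Eassoc.
- exact: (lift _ _ (assoc _ _ _) (assoc _ _ _) (Eassoc o p q)).
- exact: Elunit.
- exact: (lift _ _ (lunit _) (lunit _) (Elunit o)).
- exact: Erunit.
- exact: (lift _ _ (runit _) (runit _) (Erunit o)).
- by rewrite /= comp1m -compmA sm_eval_iso_ttyV.
- by rewrite /= !compmA bwdK comp1m -!compmA sm_eval_iso_ttyV.
- rewrite /= !compmA sm_eval_iso_tty bwdK comp1m.
  by rewrite -!compmA sm_eval_iso_ttyV.
- rewrite /= !compmA sm_eval_iso_tty bwdK comp1m.
  by rewrite -!compmA sm_eval_iso_ttyV.
Qed.

Program Definition sm_eval_trans (Th : theory) (C : MonCat)
    (G : SMFunctor (classifying Th) C) :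
    MonTrans (eval_sm (classify Th C G)) G :=
  {| mt := fun o : classifying Th => sm_eval_iso G o |}.
Next Obligation. by rewrite sm_eval_iso_nat cls_sval. Qed.
Next Obligation. by rewrite compm1. Qed.
Next Obligation. by rewrite compm1. Qed.

Definition sm_eval_niso (Th : theory) (C : MonCat)
    (G : SMFunctor (classifying Th) C) :
    @iso (Hom (classifying Th) C) (eval_sm (classify Th C G)) G :=
  @mt_iso _ _ (eval_sm (classify Th C G)) G (sm_eval_iso G) (sm_eval_trans G)
    (fun _ => erefl).

Lemma interp_push_eval (Th : theory) (C : MonCat) (M : model Th C) x A t B
    (d : deriv x A t B) :
  interp (push_pre (eval_sm M) (generic_pre Th)) d = interp M d.
Proof.
(* With [N] a variable, the equality can be eliminated. In the application the object assignments
   agree by computation, so [p] is reflexivity and both casts are identities. *)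
have H (N : prestructure Th C) (e : N = M) (p : forall A, ty N A = ty M A) :
    interp M d =
    eq_mor (p B) ∘ interp N d ∘ eq_mor (esym (p A)).
  subst N; rewrite (proof_irrelevance _ (p A) erefl).
  by rewrite (proof_irrelevance _ (p B) erefl) compm1 comp1m.
by rewrite (H _ (push_eval_generic M) (fun _ => erefl)) comp1m compm1.
Qed.

Program Definition eval_generic_iso (Th : theory) (C : MonCat)
    (M : Mod Th C) : @iso (Mod Th C) (classify Th C (eval_sm M)) M :=
  {| fwd := {| smor := fun a => idm (ob (prestr (str M)) a) |}
       : @hom (Mod Th C) (classify Th C (eval_sm M)) M;
     bwd := {| smor := fun a => idm (ob (prestr (str M)) a) |}
       : @hom (Mod Th C) M (classify Th C (eval_sm M)) |}.
Next Obligation.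
by rewrite (interp_push_eval M) !ty_hom1 comp1m compm1.
Qed.
Next Obligation.
by rewrite (interp_push_eval M) !ty_hom1 comp1m compm1.
Qed.
Next Obligation. by apply: str_mor_ext => a /=; rewrite comp1m. Qed.
Next Obligation. by apply: str_mor_ext => a /=; rewrite comp1m. Qed.

Lemma classify_equivalence (Th : theory) (C : MonCat) :
  is_equivalence (classify Th C).
Proof.
exists (eval_classify Th C); split.
  exists (@sm_eval_niso Th C) => G G' a; apply: MonTrans_ext => /=.
  (* Naturality in [G] is checked tree by tree; the unit and tensor cases are the monoidality of
     [a]. *)
  elim=> /= [|b|o IHo p IHp]; first by rewrite compm1 -(mt_phi0 a).
    by rewrite comp1m compm1.
  rewrite -compmA -tensmM IHo IHp tensmM !compmA.
  by rewrite -(mt_phi a).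
exists (@eval_generic_iso Th C) => M N h; apply: str_mor_ext => a /=.
by rewrite comp1m compm1.
Qed.

(** * Naturality in the target category *)

Lemma functor_ext (C D : Category) (F G : Functor C D)
    (e : forall x, F x = G x) :
  (forall (x y : C) (f : hom x y),
     eq_mor (e y) ∘ fmap F f = fmap G f ∘ eq_mor (e x)) ->
  F = G.
Proof.
case: F G e => [o m p q] [o' m' p' q'] /= e E.
have eo : o = o' by apply: functional_extensionality_dep.
subst o'; have em : m = m'.
  apply: functional_extensionality_dep => x.
  apply: functional_extensionality_dep => y.
  apply: functional_extensionality_dep => f; have := E x y f.
  (* Once the object maps are identified, each [e x] is a loop, so its cast is an identity. *)
  rewrite !(proof_irrelevance _ (e _) erefl).
  by rewrite comp1m compm1.
by subst m'; rewrite (proof_irrelevance _ p p') (proof_irrelevance _ q q').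
Qed.

(** When the object assignments agree by computation, [p] may be [erefl], and the cast between equal
    models then has identity components. *)
Lemma smor_eq_mor (Th : theory) (C : MonCat) (M N : Mod Th C) (e : M = N)
    (a : sort Th) (p : ob (prestr (str M)) a = ob (prestr (str N)) a) :
  smor (eq_mor e) a = eq_mor p.
Proof. by case: N / e p => p; rewrite (proof_irrelevance _ p erefl). Qed.

Lemma model_ext (Th : theory) (C : MonCat) (M N : model Th C) :
  prestr (str M) = prestr (str N) -> M = N.
Proof.
case: M N => [[M i] s] [[N j] t] /= e; subst N.
have e := proof_irrelevance _ i j; subst j.
by rewrite (proof_irrelevance _ s t).
Qed.

Lemma phi_ty_comp_sm (T : Type) (B C D : MonCat) (F : SMFunctor C D)
    (G : SMFunctor B C) (o : T -> B) (A : seq T) :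
  phi_ty (sm_comp F G) o A =
  iso_comp (fmap_iso F (phi_ty G o A)) (phi_ty F (fun a => G (o a)) A).
Proof.
apply: iso_ext; elim: A => [|a A IH] //=.
rewrite IH -[idm _]comp1m -{1}(fmap1 F) tensmM fmapM -!compmA; congr (_ ∘ _).
by rewrite !compmA phi_nat comp1m.
Qed.

(** The coherence corrections of a composite functor are composites of corrections, so pushing is
    strictly functorial and the naturality squares commute on the nose. *)
Lemma push_pre_comp (L : language) (B C D : MonCat) (F : SMFunctor C D)
    (G : SMFunctor B C) (M : prestructure L B) :
  push_pre F (push_pre G M) = push_pre (sm_comp F G) M.
Proof.
apply: prestructure_ext => // [f|w A|w n s A|w A] /=;
  rewrite !phi_ty_comp_sm /= !fmapM -!compmA //.
Qed.

Lemma classify_natural (Th : theory) : is_natural (classify Th).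
Proof.
split=> [C D F|C D F F' q G e e'].
  have e (G : SMFunctor (classifying Th) C) :
      functor_comp (Mod_map Th F) (classify Th C) G =
      functor_comp (classify Th D) (Hom_map (classifying Th) F) G.
    by apply: model_ext; apply: push_pre_comp.
  apply: (@functor_ext (Hom _ C) (Mod Th D) _ _ e) => G G' a.
  apply: str_mor_ext => b /=.
  by rewrite (smor_eq_mor (e G) (a := b) erefl)
    (smor_eq_mor (e G') (a := b) erefl) comp1m compm1.
(* Up to trivial casts, both components at [b] are [q (G (TAtom b))]. *)
apply: str_mor_ext => b /=.
by rewrite (smor_eq_mor e (a := b) erefl) (smor_eq_mor e' (a := b) erefl)
  comp1m compm1.
Qed.

Theorem theorem4p3 (Th : theory) :
  exists (T : MonCat) (E : forall C : MonCat, Functor (Hom T C) (Mod Th C)),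
    (forall C : MonCat, is_equivalence (E C)) /\ is_natural E.
Proof.
exists (classifying Th), (classify Th); split.
  exact: classify_equivalence.
exact: classify_natural.
Qed.
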